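(* Let $0<p\le 1$ and let $\sigma$ be a chip configuration on the constant graphon $C_p$ such that $\sigma(v)<p$ for almost every $v\in[0,1]$, $\lambda(\{v:\sigma(v)=c\})=0$ for every $c\in\mathbb{R}$, and $\overline{\Phi}_{\frac1p\sigma,y}^q\neq \mathrm{Id}$ for every $y\in[0,1]$ and every integer $q\ge1$. Then the activity diagram $y\mapsto s(C_p,\sigma)(y)$, $y\in[0,1]$, is a Devil's staircase. Moreover, if $\alpha$ is irrational then $s(C_p,\sigma)^{-1}(\alpha)$ is a single point, and if $y$ is rational then $s(C_p,\sigma)^{-1}(y)$ is an interval of positive length.
   Context: $C_p$ is the graphon with $C_p(x,y)=p$ for all $x,y$; so $\deg_{C_p}\equiv p$. A chip configuration is an a.e. non-negative $L^1$ function on $[0,1]$; parallel chip-firing on a graphon $W$: firing vector $f(x)=\lfloor\sigma(x)/\deg_W(x)\rfloor$, update $U\sigma(x)=\sigma(x)-\deg_W(x)f(x)+\int_0^1 f(y)W(x,y)\,dy$, odometer $u_n(x)=\sum_{i<n}f(W,U^i\sigma)(x)$, activity $a(W,\sigma)=\lim_n u_n(x)/n$ (same for a.e. $x$). The activity diagram is $s(W,\sigma)(y)=a(W,\sigma+y\deg_W)$. For a chip configuration $\tau$ and $y\in\mathbb{R}$, $\Phi_{\tau,y}:\mathbb{R}\to\mathbb{R}$ is $\Phi_{\tau,y}(x)=\lceil x\rceil-\lambda(\{v\in[0,1]:\tau(v)<\lceil x\rceil-x\})+y$; it satisfies $\Phi_{\tau,y}(x+1)=\Phi_{\tau,y}(x)+1$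 and $\overline{\Phi}_{\tau,y}$ denotes the induced map of the circle $\mathbb{R}/\mathbb{Z}$. A function $c:[a,b]\to[0,1]$ is a Devil's staircase if $c(a)=0$, $c(b)=1$, $c$ is continuous and nondecreasing, and $c$ is locally constant on an open dense set.
   Formalization: The preimages of α and y are taken in all of ℝ, with s(C_p,σ)(y) defined by the same formula for every real y, since within [0,1] the claim fails at the rational values 0 or 1 (e.g. σ(v)=p√v gives preimage {0} of 0); for values in (0,1) nothing changes. *)

(* Defs.v *)
From HB Require Import structures.
From mathcomp Require Import all_boot all_order all_algebra.
From mathcomp Require Import generic_quotient.
From mathcomp Require Import all_classical all_reals all_analysis.

Set Implicit Arguments.
Unset Strict Implicit.
Unset Printing Implicit Defensive.

Import Order.TTheory GRing.Theory Num.Theory.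
Import numFieldNormedType.Exports.

Local Open Scope classical_set_scope.
Local Open Scope ring_scope.

(* Functions on [0,1] and on [0,1]^2 are represented by total functions on R
   and R * R, of which only the values on [0,1] (resp. [0,1]^2) matter. *)

Section ChipFiring.
Variable R : realType.
Implicit Types (W : R -> R -> R) (sigma tau : R -> R).

Local Notation lambda := (@lebesgue_measure R).
Local Notation I01 := (`[0, 1]%classic : set R).

Definition is_graphon W : Prop :=
  [/\ measurable_fun (I01 `*` I01) (fun z : R * R => W z.1 z.2),
      {in I01 &, forall x y, W x y = W y x} &
      {in I01 &, forall x y, 0 <= W x y <= 1}].

Definition const_graphon (p : R) : R -> R -> R := fun _ _ => p.

Lemma const_graphonP (p : R) : 0 < p <= 1 -> is_graphon (const_graphon p).
Proof.
move=> /andP[p0 p1]; split=> // x y _ _.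
by rewrite (ltW p0).
Qed.

Definition deg W (x : R) : R := Rintegral lambda I01 (W x).

Definition chip_configuration sigma : Prop :=
  lambda.-integrable I01 (EFin \o sigma) /\
  {ae lambda, forall v, v \in I01 -> 0 <= sigma v}.

Definition firing W sigma (x : R) : R := (Num.floor (sigma x / deg W x))%:~R.

Definition update W sigma (x : R) : R :=
  sigma x - deg W x * firing W sigma x
  + Rintegral lambda I01 (fun y => firing W sigma y * W x y).

Definition odometer W sigma (n : nat) (x : R) : R :=
  \sum_(i < n) firing W (iter i (update W) sigma) x.

Definition is_activity W sigma (a : R) : Prop :=
  {ae lambda, forall x, x \in I01 ->
    (fun n => odometer W sigma n x / n%:R) @ \oo --> a}.

(* The default value 0 is only used when no a satisfies is_activity. *)
Definition activity W sigma : R := xget 0 (is_activity W sigma).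

(* Defined for every real y: firing, update and odometer make sense whether or
   not sigma + y * deg W is non-negative. *)
Definition activity_diagram W sigma (y : R) : R :=
  activity W (fun x => sigma x + y * deg W x).

Definition Phi tau (y x : R) : R :=
  (Num.ceil x)%:~R
  - fine (lambda [set v | v \in I01 /\ tau v < (Num.ceil x)%:~R - x])
  + y.

Definition eq_mod1 (x y : R) : bool := (x - y) \is a Num.int.

Lemma eq_mod1_refl : reflexive eq_mod1.
Proof. by move=> x; rewrite /eq_mod1 subrr rpred0. Qed.

Lemma eq_mod1_sym : symmetric eq_mod1.
Proof. by move=> x y; rewrite /eq_mod1 -opprB rpredN. Qed.

Lemma eq_mod1_trans : transitive eq_mod1.
Proof.
by move=> y x z xy yz; rewrite /eq_mod1 -(subrKA y) rpredD.
Qed.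

Canonical eq_mod1_equiv :=
  EquivRel eq_mod1 eq_mod1_refl eq_mod1_sym eq_mod1_trans.

Definition circle := {eq_quot eq_mod1}%qT.

(* Independent of the representative as soon as F (x + 1) = F x + 1, see
   circle_map_pi. *)
Definition circle_map (F : R -> R) (z : circle) : circle :=
  \pi_circle%qT (F (repr z)).

Lemma circle_map_pi (F : R -> R) (x : R) :
  (forall t, F (t + 1) = F t + 1) ->
  circle_map F (\pi_circle%qT x) = \pi_circle%qT (F x).
Proof.
move=> F1.
have FD t (n : nat) : F (t + n%:R) = F t + n%:R.
  by elim: n => [|n IH]; rewrite ?addr0// -natr1 !addrA F1 IH.
have FZ t (m : int) : F (t + m%:~R) = F t + m%:~R.
  case: m => n; first exact: FD.
  by rewrite NegzE mulrNz -[t in RHS](subrK n.+1%:R) FD addrK.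
have /eqP : \pi_circle%qT (repr (\pi_circle%qT x)) = \pi_circle%qT x.
  by rewrite reprK.
rewrite /circle_map; move: (repr _) => r.
rewrite piE /= => /intrP[m rx]; apply/eqP; rewrite piE /=; apply/intrP; exists m.
by rewrite -[r](subrK x) rx (addrC _ x) FZ addrAC subrr add0r.
Qed.

Lemma Phi_add1 tau (y x : R) : Phi tau y (x + 1) = Phi tau y x + 1.
Proof.
have -> : Phi tau y (x + 1) = (Num.ceil x + 1)%:~R
    - fine (lambda [set v | v \in I01 /\ tau v < (Num.ceil x)%:~R - x]) + y.
  by rewrite /Phi ceilDrz// ceil1 intrD opprD addrACA subrr addr0.
by rewrite /Phi intrD -!addrA; congr +%R; rewrite addrC !addrA.
Qed.

(* A relatively open subset of [a, b] is U `&` `[a, b] for some open U. *)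
Definition devils_staircase (a b : R) (c : R -> R) : Prop :=
  [/\ {in `[a, b], forall x, 0 <= c x <= 1},
      c a = 0 /\ c b = 1,
      {within `[a, b], continuous c},
      {in `[a, b] &, {homo c : x y / x <= y}} &
      exists U : set R,
        [/\ open U,
            `[a, b] `<=` closure (U `&` `[a, b]) &
            forall x, (U `&` `[a, b]) x ->
              \forall z \near x, z \in `[a, b] -> c z = c x]].

End ChipFiring.

(* Main.v *)
Require Import Defs.
From HB Require Import structures.
From mathcomp Require Import all_boot all_order all_algebra.
From mathcomp Require Import generic_quotient.
From mathcomp Require Import all_classical all_reals all_analysis.
From mathcomp Require Import measurable_realfun ring lra zify.

Import Order.TTheory GRing.Theory Num.Theory.
Import numFieldNormedType.Exports.

Local Open Scope classical_set_scope.
Local Open Scope ring_scope.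

(** Put tau = sigma / p and G = Phi tau 0, so that Phi tau y = G + y. On a
    constant graphon the odometer telescopes: u_(n+1)(x) = floor (tau x + z_n)
    with z_0 = y and z_(n+1) = y + \int floor (tau + z_n) = G (z_n) + y. Hence
    the activity at y is the rotation number rho y of the degree one map G + y,
    which is nondecreasing, and continuous since tau has no atoms.

    From |F^n 0 - n rho| <= 1 the function rho is monotone and continuous in y.
    If rho took an irrational value on an interval of parameters, an almost
    periodic orbit of the midpoint map would become an exact inequality
    F^q x <= x + a or F^q x >= x + a after perturbing y, which forces
    rho = a / q. If it took the value a / q at a single y, then
    F^q x >= x + a for larger parameters and F^q x <= x + a for smaller ones,
    so F^q = id + a at y by continuity, contrary to the hypothesis. The
    plateaus over rational values are therefore nondegenerate, and they are
    dense because the rationals are. *)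

(** * Rotation numbers of the maps G + y *)

(** Archimedean property. It turns orbit estimates whose error is bounded uniformly in [n] into
    exact inequalities between rotation numbers. *)
Lemma le0_of_mulrn_le (R : realType) (d C : R) :
  (forall n : nat, n%:R * d <= C) -> d <= 0.
Proof.
move=> h; rewrite leNgt; apply/negP => d0.
have := h (Num.truncn (C / d)).+1.
rewrite leNgt -ltr_pdivrMr //.
by rewrite truncnS_gt.
Qed.

Lemma pigeonhole_mod1 (R : realType) (z : nat -> R) (e : R) : 0 < e ->
  exists (m q : nat) (a : int), (0 < q)%N /\ `|z (q + m)%N - z m - a%:~R| < e.
Proof.
move=> e0; pose N := (Num.truncn e^-1).+1.
have N0 : 0 < N%:R :> R by rewrite ltr0n.
have Ne : N%:R^-1 < e by rewrite invf_plt ?posrE// truncnS_gt.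
pose fr n := z n - (Num.floor (z n))%:~R.
have fr0 n : 0 <= fr n by rewrite subr_ge0 floor_le.
have fr1 n : fr n < 1 by rewrite ltrBlDl -[X in _ + X]/(1%:~R) -intrD floorD1_gt.
have frN n : (Num.truncn (N%:R * fr n) < N)%N.
  rewrite -(ltr_nat R); apply: le_lt_trans (_ : N%:R * fr n < _).
    by rewrite truncn_le mulr_ge0 // ltW.
  by rewrite -[ltRHS]mulr1 ltr_pM2l.
(* Dirichlet's argument: [N.+1] fractional parts fall into [N] cells of length [1 / N < e], so two
   share a cell. *)
pose g (i : 'I_N.+1) : 'I_N := Ordinal (frN i).
have : ~ injective g.
  by move/leq_card; rewrite !card_ord ltnn.
move=> /existsNP[i /existsNP[j /not_implyP[gij nij]]].
wlog ij : i j gij nij / (i < j)%N.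
  move=> H; case: (ltngtP i j) => [ij|ji|eij].
  - exact: (H i j).
  - by apply: (H j i) => //; exact/nesym.
  - by case: nij; exact/val_inj.
exists i, (j - i)%N, (Num.floor (z j) - Num.floor (z i)).
split; first by rewrite subn_gt0.
rewrite subnK; last exact: ltnW.
have -> : z j - z i - (Num.floor (z j) - Num.floor (z i))%:~R = fr j - fr i.
  by rewrite /fr intrB; ring.
apply: lt_trans Ne.
have tr n : (Num.truncn (N%:R * fr n))%:R <= N%:R * fr n <
    (Num.truncn (N%:R * fr n))%:R + 1.
  by rewrite natr1 truncnS_gt truncn_le mulr_ge0 // ltW.
have := tr i; have := tr j.
have -> : Num.truncn (N%:R * fr i) = Num.truncn (N%:R * fr j) by case: gij.
move=> /andP[h1 h2] /andP[h3 h4].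
rewrite -[ltRHS]mul1r ltr_pdivlMr // -[X in _ * X]gtr0_norm // -normrM ltr_norml.
by apply/andP; split; lra.
Qed.

Section Rotation.
Context {R : realType} (G : R -> R).
Hypothesis G_cont : continuous G.
Hypothesis G_homo : {homo G : x y / x <= y}.
Hypothesis G_add1 : forall x, G (x + 1) = G x + 1.

Local Notation orb y n x := (iter n (fun t => G t + y) x).

Lemma degree_one_addz x (m : int) : G (x + m%:~R) = G x + m%:~R.
Proof.
have GD t (n : nat) : G (t + n%:R) = G t + n%:R.
  by elim: n => [|n IH]; rewrite ?addr0// -natr1 !addrA G_add1 IH.
case: m => n; first exact: GD.
by rewrite NegzE mulrNz -[x in RHS](subrK n.+1%:R) GD addrK.
Qed.

Lemma orbit_addz y n x (m : int) : orb y n (x + m%:~R) = orb y n x + m%:~R.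
Proof. by elim: n => //= n ->; rewrite degree_one_addz addrAC. Qed.

Lemma orbit_le y y' n x x' : y <= y' -> x <= x' -> orb y n x <= orb y' n x'.
Proof. by move=> yy xx; elim: n => //= n IH; rewrite lerD // G_homo. Qed.

Lemma orbit_paramz y (m : int) n x :
  orb (y + m%:~R) n x = orb y n x + (n%:Z * m)%:~R.
Proof.
elim: n => [|n IH]; first by rewrite mul0r addr0.
rewrite !iterS IH degree_one_addz intS mulrDl mul1r intrD; lra.
Qed.

(** Monotonicity squeezes the orbit of [x] between those of [floor x] and [floor x + 1], which are
    integer translates of the orbit of [0]. *)
Lemma orbit_shift_bounds y n x :
  orb y n 0 + x - 1 <= orb y n x <= orb y n 0 + x + 1.
Proof.
have /andP[f1 f2] := floor_itv x.
have := orbit_addz y n 0 (Num.floor x); rewrite add0r => e0.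
have := orbit_addz y n 0 (Num.floor x + 1); rewrite add0r => e1.
have h0 := orbit_le y y n _ _ (lexx y) f1.
have h1 := orbit_le y y n _ _ (lexx y) (ltW f2).
rewrite e0 in h0; rewrite e1 in h1.
rewrite intrD in f2 h1.
by apply/andP; split; lra.
Qed.

Lemma orbit_mul_bounds y m n :
  n%:R * (orb y m 0 - 1) <= orb y (n * m) 0 <= n%:R * (orb y m 0 + 1).
Proof.
elim: n => [|n /andP[IH1 IH2]]; first by rewrite mul0n !mul0r lexx.
rewrite mulSn iterD.
have /andP[h1 h2] := orbit_shift_bounds y m (orb y (n * m) 0).
by rewrite -natr1 !mulrDl !mul1r; apply/andP; split; lra.
Qed.

(** The limit of [orb y n 0 / n], encoded as a supremum of lower estimates: it exists without a
    convergence proof, and the error bound [1] comes with it. *)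
Definition rotation_number y : R :=
  sup [set (orb y n.+1 0 - 1) / n.+1%:R | n in [set: nat]].

Lemma rotation_number_bounds y n :
  n%:R * rotation_number y - 1 <= orb y n 0 <= n%:R * rotation_number y + 1.
Proof.
(* Every upper estimate dominates every lower one: estimate the iterate of order [m.+1 * k.+1] once
   as blocks of length [m.+1] and once as blocks of length [k.+1]. *)
have ub k : ubound [set (orb y n.+1 0 - 1) / n.+1%:R | n in [set: nat]]
    ((orb y k.+1 0 + 1) / k.+1%:R).
  move=> _ [m _ <-]; rewrite ler_pdivrMr // mulrAC ler_pdivlMr //.
  have /andP[h1 _] := orbit_mul_bounds y m.+1 k.+1.
  have /andP[_ h2] := orbit_mul_bounds y k.+1 m.+1.
  rewrite mulnC in h2; rewrite mulrC (mulrC (_ + 1)).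
  exact: le_trans h1 h2.
case: n => [|n]; first by rewrite !mul0r /=; apply/andP; split; lra.
apply/andP; split.
  rewrite lerBlDr -ler_pdivlMl // mulrC; apply: ge_sup; last exact: ub.
  by exists ((orb y 1 0 - 1) / 1), 0%N.
rewrite -lerBlDr -ler_pdivrMl // mulrC; apply: ub_le_sup; last by exists n.
by exists ((orb y 1 0 + 1) / 1); exact: ub.
Qed.

Lemma orbit_rotation_bounds y n x :
  x + n%:R * rotation_number y - 2 <= orb y n x <=
  x + n%:R * rotation_number y + 2.
Proof.
have /andP[h1 h2] := rotation_number_bounds y n.
have /andP[h3 h4] := orbit_shift_bounds y n x.
by apply/andP; split; lra.
Qed.

(** By monotonicity and integer translation the inequality iterates to a displacement of at most
    [n * a] after [n * q] steps, while that displacement is [n * q * rho] up to [2]. *)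
Lemma rotation_number_le_of_orbit y (q : nat) (a : int) x :
  orb y q x <= x + a%:~R -> q%:R * rotation_number y <= a%:~R.
Proof.
move=> h; rewrite -subr_le0; apply: (@le0_of_mulrn_le _ _ 2) => n.
have : orb y (n * q) x <= x + n%:R * a%:~R.
  elim: n => [|n IH]; first by rewrite mul0n mul0r addr0.
  rewrite mulSn iterD.
  apply: le_trans (orbit_le y y q _ _ (lexx y) IH) _.
  have -> : n%:R * a%:~R = (n%:Z * a)%:~R :> R by rewrite intrM.
  rewrite orbit_addz intrM -natr1; rewrite mulrDl mul1r; lra.
have /andP[h1 _] := orbit_rotation_bounds y (n * q) x.
rewrite natrM in h1.
lra.
Qed.

Lemma rotation_number_ge_of_orbit y (q : nat) (a : int) x :
  x + a%:~R <= orb y q x -> a%:~R <= q%:R * rotation_number y.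
Proof.
move=> h; rewrite -subr_le0; apply: (@le0_of_mulrn_le _ _ 2) => n.
have : x + n%:R * a%:~R <= orb y (n * q) x.
  elim: n => [|n IH]; first by rewrite mul0n mul0r addr0.
  rewrite mulSn iterD.
  apply: le_trans (orbit_le y y q _ _ (lexx y) IH).
  have -> : n%:R * a%:~R = (n%:Z * a)%:~R :> R by rewrite intrM.
  rewrite orbit_addz intrM -natr1; rewrite mulrDl mul1r; lra.
have /andP[_ h1] := orbit_rotation_bounds y (n * q) x.
rewrite natrM in h1.
lra.
Qed.

(** * Monotonicity, continuity and values of the rotation number *)

Lemma rotation_number_homo : {homo rotation_number : y y' / y <= y'}.
Proof.
move=> y y' yy; rewrite -subr_le0; apply: (@le0_of_mulrn_le _ _ 2) => n.
have /andP[h1 _] := rotation_number_bounds y n.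
have /andP[_ h2] := rotation_number_bounds y' n.
have h3 := orbit_le y y' n 0 0 yy (lexx 0).
by rewrite mulrBr; lra.
Qed.

Lemma rotation_number_addz y (m : int) :
  rotation_number (y + m%:~R) = rotation_number y + m%:~R.
Proof.
have h n : n%:R * rotation_number (y + m%:~R) - 1 <=
    orb y n 0 + n%:R * m%:~R <= n%:R * rotation_number (y + m%:~R) + 1.
  by have := rotation_number_bounds (y + m%:~R) n; rewrite orbit_paramz intrM.
apply/eqP; rewrite eq_le -subr_le0 -[X in _ && X]subr_le0.
apply/andP; split; apply: (@le0_of_mulrn_le _ _ 2) => n;
  have /andP[h1 h2] := h n; have /andP[h3 h4] := rotation_number_bounds y n;
  rewrite !(mulrBr, mulrDr); lra.
Qed.

Lemma orbit_param_continuous n x : continuous (fun y => orb y n x).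
Proof.
elim: n => [|n IH] y /=; first exact: cvg_cst.
apply: cvgD; last exact: cvg_id.
by apply: continuous_comp; [exact: IH|exact: G_cont].
Qed.

Lemma rotation_number_continuous : continuous rotation_number.
Proof.
move=> y; apply/cvgrPdist_lt => e e0.
(* The constant [3] adds the error [1] of each of the two rotation bounds to the distance [1]
   allowed between the [n]-th iterates. *)
pose n := (Num.truncn (3 / e)).+1.
have n0 : 0 < n%:R :> R by rewrite ltr0n.
have ne : 3 < n%:R * e by rewrite -ltr_pdivrMr // truncnS_gt.
have /cvgrPdist_lt /(_ 1 ltr01) c := orbit_param_continuous n 0 y.
near=> t.
have : `|orb y n 0 - orb t n 0| < 1 by near: t; exact: c.
have /andP[h1 h2] := rotation_number_bounds y n.
have /andP[h3 h4] := rotation_number_bounds t n.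
rewrite ltr_norml => /andP[h5 h6].
rewrite -(ltr_pM2l n0) -[X in X * `|_|]gtr0_norm // -normrM ltr_norml mulrBr.
by apply/andP; split; lra.
Unshelve. all: by end_near. Qed.

Hypothesis G0 : G 0 = 0.

Lemma rotation_number_int (m : int) : rotation_number m%:~R = m%:~R.
Proof.
rewrite -[m%:~R in LHS]add0r rotation_number_addz -[RHS]add0r; congr (_ + _).
have h : orb 0 1 0 = 0 + (0 : int)%:~R by rewrite /= G0 !addr0.
apply/eqP; rewrite eq_le -[rotation_number 0]mul1r.
rewrite (@rotation_number_le_of_orbit 0 1 0 0) ?h//.
by rewrite (@rotation_number_ge_of_orbit 0 1 0 0) ?h.
Qed.

Lemma rotation_number_surj a : exists y, rotation_number y = a.
Proof.
have /andP[f1 f2] := floor_itv a.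
have le : (Num.floor a)%:~R <= (Num.floor a + 1)%:~R :> R by rewrite ler_int; lia.
have [||y _ <-] := @IVT _ rotation_number _ _ a le; last by exists y.
- by apply: continuous_subspaceT; exact: rotation_number_continuous.
- by rewrite !rotation_number_int min_l // max_r // f1 ltW.
Qed.

(* An almost-return F^q x - a of the orbit at the midpoint parameter lies on
   one side of x, and moving the parameter by e pushes it past x; both
   parameters then have their rotation numbers on opposite sides of a / q. *)
Lemma rotation_number_irrational_inj y y' :
  irrational (rotation_number y) -> rotation_number y = rotation_number y' ->
  y = y'.
Proof.
wlog yy : y y' / y < y'.
  move=> H irr e; case: (ltgtP y y') => // yy.
    exact: H.
  by apply/esym/H => //; rewrite -e.
move=> irr e; case: irr.
pose z := (y + y') / 2; pose d := (y' - y) / 2.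
have d0 : 0 < d by rewrite /d; lra.
have ez : rotation_number z = rotation_number y.
  apply/eqP; rewrite eq_le {1}e.
  by rewrite !rotation_number_homo // /z; lra.
have rat (q : nat) (a : int) : (0 < q)%N ->
    q%:R * rotation_number y = a%:~R -> rational (rotation_number y).
  move=> q0 qa; exists (a%:~R / q%:R) => //.
  rewrite fmorph_div rmorph_int rmorph_nat -qa mulrC mulKf //.
  by rewrite pnatr_eq0 -lt0n.
have [m [q [a [q0]]]] := @pigeonhole_mod1 _ (fun n => orb z n 0) _ d0.
rewrite iterD; set x := orb z m 0; rewrite ltr_norml => /andP[h1 h2].
(* The last iteration alone gains [d]; the earlier ones only preserve the order. *)
have step u v n t : u + d <= v -> (0 < n)%N -> orb u n t + d <= orb v n t.
  move=> uv; case: n => // n _ /=.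
  have := @orbit_le u v n t t; rewrite lexx => /(_ _ isT) hh.
  have /hh/G_homo : u <= v by lra.
  lra.
apply: (rat q a) => //; apply/eqP; rewrite eq_le.
have [xa|ax] := leP (orb z q x) (x + a%:~R).
- rewrite -{1}ez (@rotation_number_le_of_orbit z q a x) //=.
  rewrite e (@rotation_number_ge_of_orbit y' q a x) //.
  have : orb z q x + d <= orb y' q x by apply: step => //; rewrite /z /d; lra.
  lra.
- rewrite -[in X in _ && X]ez (@rotation_number_ge_of_orbit z q a x) ?(ltW ax)// andbT.
  rewrite (@rotation_number_le_of_orbit y q a x) //.
  have : orb y q x + d <= orb z q x by apply: step => //; rewrite /z /d; lra.
  lra.
Qed.

Lemma rotation_number_rational_singleton y (q : nat) (a : int) :
  (0 < q)%N -> q%:R * rotation_number y = a%:~R ->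
  (forall y', rotation_number y' = rotation_number y -> y' = y) ->
  forall x, orb y q x = x + a%:~R.
Proof.
move=> q0 ya uniq x.
have q0' : 0 < q%:R :> R by rewrite ltr0n.
have cont := @orbit_param_continuous q x y.
(* The sign [d = -1] or [d = 1] selects the side from which the parameter tends to [y]; each side
   yields one of the two inequalities. *)
have nb (e d : R) : 0 < e -> \forall t \near 0^'+, `|orb y q x - orb (y + d * t) q x| < e.
  move=> e0.
  have yd : (fun t => y + d * t) @ 0^'+ --> y.
    apply: cvg_at_right_filter.
    rewrite -[X in _ --> X]addr0 -[X in _ + X](mulr0 d).
    by apply: cvgD; [exact: cvg_cst|apply: cvgMl_tmp; exact: cvg_id].
  have c : (fun t => orb (y + d * t) q x) @ 0^'+ --> orb y q x.
    exact: cvg_comp yd cont.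
  by move/cvgrPdist_lt : c => /(_ e e0).
apply/eqP; rewrite eq_le; apply/andP; split; apply/ler_addgt0Pl => e e0.
- near (0 : R)^'+ => t.
  have t0 : 0 < t by near: t; exact: nbhs_right_gt.
  have : `|orb y q x - orb (y + (-1) * t) q x| < e by near: t; exact: nb.
  rewrite ltr_norml => /andP[_ h].
  suff : orb (y + -1 * t) q x <= x + a%:~R by lra.
  (* Otherwise the rotation number at [y - t] is at least that at [y], hence equal to it by
     monotonicity, and uniqueness of [y] forces [t = 0]. *)
  rewrite leNgt; apply/negP => /ltW/rotation_number_ge_of_orbit.
  rewrite -ya ler_pM2l // => h'.
  have : y + -1 * t = y.
    by apply: uniq; apply/eqP; rewrite eq_le h' rotation_number_homo //; lra.
  lra.
- near (0 : R)^'+ => t.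
  have t0 : 0 < t by near: t; exact: nbhs_right_gt.
  have : `|orb y q x - orb (y + 1 * t) q x| < e by near: t; exact: nb.
  rewrite ltr_norml => /andP[h _].
  suff : x + a%:~R <= orb (y + 1 * t) q x by lra.
  rewrite leNgt; apply/negP => /ltW/rotation_number_le_of_orbit.
  rewrite -ya ler_pM2l // => h'.
  have : y + 1 * t = y.
    by apply: uniq; apply/eqP; rewrite eq_le h' rotation_number_homo //; lra.
  lra.
Unshelve. all: by end_near. Qed.

(** * Plateaus over the rationals and the Devil's staircase *)

Hypothesis not_periodic : forall (y : R) (q : nat) (a : int),
  0 <= y <= 1 -> (0 < q)%N -> ~ (forall x, orb y q x = x + a%:~R).

Lemma rotation_number_plateau r : rational r ->
  exists y y', [/\ y < y', rotation_number y = r & rotation_number y' = r].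
Proof.
move=> [k _ rk]; have [y yr] := rotation_number_surj r.
apply: contrapT => H.
have uniq y' : rotation_number y' = rotation_number y -> y' = y.
  rewrite yr => y'r; case: (ltgtP y' y) => // yy; case: H.
    by exists y', y.
  by exists y, y'.
pose q := `|denq k|%N.
have q0 : (0 < q)%N by rewrite absz_gt0 denq_neq0.
have qE : q%:R = (denq k)%:~R :> R by rewrite /q pmulrn gez0_abs // ltW // denq_gt0.
have ya : q%:R * rotation_number y = (numq k)%:~R.
  rewrite yr -rk qE /ratr mulrCA mulfV ?mulr1 //.
  by rewrite intr_eq0 denq_neq0.
have per := rotation_number_rational_singleton _ _ _ q0 ya uniq.
have /andP[f1 f2] := floor_itv y.
(* Periodicity is excluded for parameters in [[0, 1]] only, so [y] is replaced by its fractional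
   part; [q] steps then shift the translation by [- q * floor y]. *)
apply: (not_periodic (y + (- Num.floor y)%:~R) q (numq k + q%:Z * - Num.floor y) _ q0).
  by rewrite intrD in f2; rewrite mulrNz; apply/andP; split; lra.
by move=> x; rewrite orbit_paramz per intrD addrA.
Qed.

(** Either the values at [l] and [u] agree and monotonicity gives constancy between them, or a
    rational lies strictly between these values and its plateau lies inside []l, u[]. *)
Lemma rotation_number_locally_constant l u : l < u ->
  exists2 x, l < x < u & \forall z \near x, rotation_number z = rotation_number x.
Proof.
move=> lu.
have const a b : a < b -> rotation_number a = rotation_number b ->
    \forall z \near (a + b) / 2, rotation_number z = rotation_number ((a + b) / 2).
  move=> ab eab.
  have cst t : a <= t -> t <= b -> rotation_number t = rotation_number a.
    move=> at_ tb; apply/eqP; rewrite eq_le {1}eab.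
    by rewrite !rotation_number_homo.
  have h : (a + b) / 2 \in `]a, b[ by rewrite in_itv /=; apply/andP; split; lra.
  near=> z.
  have : z \in `]a, b[ by near: z; exact: near_in_itvoo.
  rewrite in_itv /= => /andP[az zb].
  by rewrite !cst //; lra.
have [e|ne] := eqVneq (rotation_number l) (rotation_number u).
  by exists ((l + u) / 2); [apply/andP; split; lra|exact: const].
have ltr : rotation_number l < rotation_number u.
  by rewrite lt_neqAle ne rotation_number_homo // ltW.
have [k] := rat_in_itvoo ltr; rewrite in_itv /= => /andP[k1 k2].
have [|y [y' [yy ey ey']]] := rotation_number_plateau (ratr k).
  by exists k.
have ly : l < y.
  by rewrite ltNge; apply/negP => /rotation_number_homo; rewrite ey leNgt k1.
have yu : y' < u.
  by rewrite ltNge; apply/negP => /rotation_number_homo; rewrite ey' leNgt k2.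
exists ((y + y') / 2); first by apply/andP; split; lra.
by apply: const => //; rewrite ey.
Unshelve. all: by end_near. Qed.

Lemma rotation_number_devils_staircase : devils_staircase 0 1 rotation_number.
Proof.
have rho0 : rotation_number 0 = 0 by exact: (rotation_number_int 0).
have rho1 : rotation_number 1 = 1 by exact: (rotation_number_int 1).
split.
- move=> x; rewrite in_itv /= => /andP[x0 x1].
  by rewrite -{1}rho0 -rho1 !rotation_number_homo.
- by [].
- by apply: continuous_subspaceT; exact: rotation_number_continuous.
- by move=> x y _ _; exact: rotation_number_homo.
exists (\bigcup_c (rotation_number @^-1` [set c])°); split.
- by apply: bigcup_open => c _; exact: open_interior.
- move=> x /=; rewrite in_itv /= => /andP[x0 x1] B /nbhs_ballP[e /= e0 eB].
  (* Clipping the ball to [[0, 1]] keeps the point found below in both, even when [x] is an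
     endpoint. *)
  pose l := Num.max 0 (x - e); pose u := Num.min 1 (x + e).
  have lu : l < u.
    by rewrite /l /u gt_max !lt_min; apply/andP; split; apply/andP; split; lra.
  have [z /andP[lz zu] hz] := rotation_number_locally_constant _ _ lu.
  move: lz zu; rewrite /l /u gt_max lt_min => /andP[z0 z1] /andP[z2 z3].
  exists z; split; last first.
    by apply: eB; rewrite /ball /= ltr_norml; apply/andP; split; lra.
  split; last by rewrite /= in_itv /=; apply/andP; split; lra.
  by exists (rotation_number z).
- move=> x [[c _ hx] _]; have cx := nbhs_singleton hx.
  by near=> z => _; rewrite cx; near: z.
Unshelve. all: by end_near. Qed.

End Rotation.

(** * The map Phi as the integral of a floor *)

Lemma ae_eq_integrable (d : measure_display) (T : measurableType d)
    (R : realType) (mu : {measure set T -> \bar R}) (D : set T)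
    (f g : T -> \bar R) : measurable D -> measurable_fun D f ->
  ae_eq mu D f g -> mu.-integrable D g -> mu.-integrable D f.
Proof.
move=> mD mf fg /integrableP[mg ig]; apply/integrableP; split => //.
rewrite (@ae_eq_integral _ _ _ _ _ (abse \o g)) //.
- exact: measurableT_comp.
- exact: measurableT_comp.
- by apply: filterS fg => x h Dx /=; rewrite h.
Qed.

Section Sublevel.
Context {R : realType} (tau : R -> R).
Local Notation lambda := (@lebesgue_measure R).
Local Notation I01 := (`[0, 1]%classic : set R).
Hypothesis tau_meas : measurable_fun I01 tau.
Hypothesis tau_itv : {ae lambda, forall v, v \in I01 -> 0 <= tau v < 1}.
Hypothesis tau_atom : forall c, lambda [set v | v \in I01 /\ tau v = c] = 0%E.

Local Notation sublevel c := [set v | v \in I01 /\ tau v < c].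

Lemma lebesgue_measure_I01 : lambda I01 = 1%E.
Proof. by rewrite lebesgue_measure_itv /= lte_fin ltr01 oppr0 addr0. Qed.

Lemma lebesgue_measure_I01_lty : (lambda I01 < +oo)%E.
Proof. by rewrite lebesgue_measure_I01 ltry. Qed.

Lemma Rintegral_cst_I01 (a : R) : Rintegral lambda I01 (fun=> a) = a.
Proof.
rewrite Rintegral_cst // -[RHS]mulr1.
exact: (congr1 (fun z => a * fine z) lebesgue_measure_I01).
Qed.

Lemma measurable_sublevel c : measurable (sublevel c).
Proof.
have -> : sublevel c = I01 `&` tau @^-1` `]-oo, c[%classic.
  by apply/seteqP; split => v /=; rewrite !inE /= !in_itv.
exact: tau_meas.
Qed.

Lemma measurable_level c : measurable [set v | v \in I01 /\ tau v = c].
Proof.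
have -> : [set v | v \in I01 /\ tau v = c] = I01 `&` tau @^-1` [set c].
  by apply/seteqP; split => v /=; rewrite !inE.
exact: tau_meas.
Qed.

(** Distribution function of [tau] with a strict inequality, hence left-continuous for any
    measurable [tau]. *)
Definition sublevel_cdf c : R := fine (lambda (sublevel c)).

Lemma sublevel_measure_le1 c : (lambda (sublevel c) <= 1)%E.
Proof.
rewrite -lebesgue_measure_I01; apply: le_measure; rewrite ?inE //.
- exact: measurable_sublevel.
- by move=> v [/set_mem].
Qed.

Lemma sublevel_cdfE c : lambda (sublevel c) = (sublevel_cdf c)%:E.
Proof.
rewrite fineK // ge0_fin_numE //.
exact: le_lt_trans (sublevel_measure_le1 c) (ltry _).
Qed.

Lemma sublevel_cdf_ge0 c : 0 <= sublevel_cdf c.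
Proof. exact: fine_ge0. Qed.

Lemma sublevel_cdf_le1 c : sublevel_cdf c <= 1.
Proof. by rewrite -lee_fin -sublevel_cdfE sublevel_measure_le1. Qed.

Lemma sublevel_cdf_homo : {homo sublevel_cdf : c c' / c <= c'}.
Proof.
move=> c c' cc; rewrite -lee_fin -!sublevel_cdfE.
apply: le_measure; rewrite ?inE; [exact: measurable_sublevel..|].
by move=> v [vI vc]; split => //; exact: lt_le_trans cc.
Qed.

Lemma sublevel_cdf_le0 c : c <= 0 -> sublevel_cdf c = 0.
Proof.
move=> c0; apply: EFin_inj; rewrite -sublevel_cdfE.
apply/negligibleP; first exact: measurable_sublevel.
apply: negligibleS tau_itv => v [vI vc] /= /(_ vI) /andP[v0 _]; lra.
Qed.

Lemma sublevel_cdf_ge1 c : 1 <= c -> sublevel_cdf c = 1.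
Proof.
move=> c1; apply: EFin_inj; rewrite -sublevel_cdfE -lebesgue_measure_I01.
have mN : measurable (I01 `\` sublevel c).
  by apply: measurableD => //; exact: measurable_sublevel.
rewrite -(@measureU0 _ _ _ lambda _ _ (measurable_sublevel c) mN).
  congr (lambda _); rewrite setDUK //.
  by move=> v [/set_mem].
apply/negligibleP => //; apply: negligibleS tau_itv => v [vI nv] /= h.
apply: nv; split; first exact/mem_set.
by have /andP[_ h1] := h (mem_set vI); lra.
Qed.

Lemma sublevel_cdf_left c e : 0 < e ->
  exists2 d, 0 < d & sublevel_cdf c - e < sublevel_cdf (c - d).
Proof.
move=> e0; pose F n := sublevel (c - n.+1%:R^-1).
have UF : \bigcup_n F n = sublevel c.
  apply/seteqP; split => [v [n _ [vI vc]]|v [vI vc]].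
    by split => //; apply: lt_trans vc _; rewrite ltrBlDr ltrDl invr_gt0.
  by have [k hk] := ltr_add_invr vc; exists k => //; split => //=; rewrite ltrBrDr.
have cv : lambda (F n) @[n --> \oo] --> lambda (\bigcup_n F n).
  apply: nondecreasing_cvg_mu.
  - by move=> n; exact: measurable_sublevel.
  - by rewrite UF; exact: measurable_sublevel.
  - move=> m n mn; apply/subsetPset => v [vI vc]; split => //.
    apply: lt_le_trans vc _; rewrite lerD2l lerN2 lef_pV2 ?posrE//.
    by rewrite ler_nat ltnS.
move: cv; rewrite UF sublevel_cdfE => /fine_cvg /cvgrPdist_lt /(_ e e0) [N _ hN].
exists N.+1%:R^-1; first by rewrite invr_gt0.
have := hN N (leqnn N); rewrite /= ltr_norml => /andP[_]; rewrite /sublevel_cdf; lra.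
Qed.

(** Continuity of the measure from above: the decreasing sublevel sets shrink to that of [c]
    together with the level set of [c], which is null as [tau] has no atoms. *)
Lemma sublevel_cdf_right c e : 0 < e ->
  exists2 d, 0 < d & sublevel_cdf (c + d) < sublevel_cdf c + e.
Proof.
move=> e0; pose F n := sublevel (c + n.+1%:R^-1).
have IF : \bigcap_n F n = sublevel c `|` [set v | v \in I01 /\ tau v = c].
  apply/seteqP; split => [v Fv|v [] [vI vc] n _].
  - have vI : v \in I01 by have [] := Fv 0%N I.
    case: (ltgtP (tau v) c) => [vc|cv|vc]; [by left| |by right].
    have [k hk] := ltr_add_invr cv.
    by have [_] := Fv k I => /(lt_trans hk); rewrite ltxx.
  - by split => //; apply: lt_trans vc _; rewrite ltrDl invr_gt0.
  - by split => //; rewrite vc ltrDl invr_gt0.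
have mIF : measurable (\bigcap_n F n).
  rewrite IF; apply: measurableU; first exact: measurable_sublevel.
  exact: measurable_level.
have cv : lambda (F n) @[n --> \oo] --> lambda (\bigcap_n F n).
  apply: nonincreasing_cvg_mu => //.
  - exact: le_lt_trans (sublevel_measure_le1 _) (ltry _).
  - by move=> n; exact: measurable_sublevel.
  - move=> m n mn; apply/subsetPset => v [vI vc]; split => //.
    apply: lt_le_trans vc _; rewrite lerD2l lef_pV2 ?posrE//.
    by rewrite ler_nat ltnS.
have IE : lambda (\bigcap_n F n) = (sublevel_cdf c)%:E.
  rewrite IF -sublevel_cdfE; apply: measureU0 => //.
  - exact: measurable_sublevel.
  - exact: measurable_level.
  - exact: tau_atom.
move: cv; rewrite IE => /fine_cvg /cvgrPdist_lt /(_ e e0) [N _ hN].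
exists N.+1%:R^-1; first by rewrite invr_gt0.
have := hN N (leqnn N); rewrite /= ltr_norml => /andP[+ _]; rewrite /sublevel_cdf; lra.
Qed.

Lemma sublevel_cdf_continuous : continuous sublevel_cdf.
Proof.
move=> c; apply/cvgrPdist_lt => e e0.
have [d d0 hd] := sublevel_cdf_left c _ e0.
have [d' d'0 hd'] := sublevel_cdf_right c _ e0.
have hc : c \in `]c - d, c + d'[ by rewrite in_itv /=; apply/andP; split; lra.
near=> t.
have : t \in `]c - d, c + d'[ by near: t; exact: near_in_itvoo.
rewrite in_itv /= => /andP[/ltW/sublevel_cdf_homo h1 /ltW/sublevel_cdf_homo h2].
by rewrite ltr_norml; apply/andP; split; lra.
Unshelve. all: by end_near. Qed.

Lemma PhiE y x :
  Phi tau y x = (Num.ceil x)%:~R - sublevel_cdf ((Num.ceil x)%:~R - x) + y.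
Proof. by []. Qed.

(** For equal ceilings this is monotonicity of the distribution function; a jump of the ceiling
    gains at least [1], which covers any variation of a function with values in [[0, 1]]. *)
Lemma Phi_homo y : {homo Phi tau y : x x' / x <= x'}.
Proof.
move=> x x' xx; rewrite !PhiE lerD2r.
have := le_ceil xx; rewrite le_eqVlt => /orP[/eqP ->|].
  by rewrite lerD2l lerN2 sublevel_cdf_homo // lerD2l lerN2.
rewrite -lezD1 -(ler_int R) intrD.
have := sublevel_cdf_ge0 ((Num.ceil x)%:~R - x).
have := sublevel_cdf_le1 ((Num.ceil x')%:~R - x').
lra.
Qed.

(* Near an integer the two branches of the ceiling glue because the measure of
   the sublevel set is 0 below level 0 and 1 above level 1. *)
Lemma Phi_near (m : int) y x : (m - 1)%:~R < x < (m + 1)%:~R ->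
  Phi tau y x =
  (m + 1)%:~R - sublevel_cdf (m%:~R - x) - sublevel_cdf ((m + 1)%:~R - x) + y.
Proof.
rewrite intrB !intrD => /andP[h1 h2].
have [xm|mx] := leP x m%:~R.
- have cx : Num.ceil x = m by apply: ceil_def; rewrite intrB; apply/andP; split; lra.
  have e1 : sublevel_cdf (m%:~R + 1 - x) = 1 by apply: sublevel_cdf_ge1; lra.
  by rewrite PhiE cx e1; ring.
- have cx : Num.ceil x = m + 1.
    by apply: ceil_def; rewrite addrK intrD; apply/andP; split; lra.
  have e0 : sublevel_cdf (m%:~R - x) = 0 by apply: sublevel_cdf_le0; lra.
  by rewrite PhiE cx e0 intrD; ring.
Qed.

Lemma Phi_continuous y : continuous (Phi tau y).
Proof.
move=> x; pose m := Num.ceil x.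
have /andP[c1 c2] := ceil_itv x.
have xm : x \in `](m - 1)%:~R, (m + 1)%:~R[.
  by rewrite in_itv /= c1 /= (le_lt_trans c2) // intrD ltrDl.
pose g t := (m + 1)%:~R - sublevel_cdf (m%:~R - t) -
  sublevel_cdf ((m + 1)%:~R - t) + y.
have gx : g x = Phi tau y x by rewrite (@Phi_near m).
rewrite /continuous_at -gx.
have cH (a : R) : (fun t => sublevel_cdf (a - t)) @ x --> sublevel_cdf (a - x).
  apply: (@continuous_comp _ _ _ (fun t => a - t)).
    by rewrite /continuous_at; apply: cvgB; [exact: cvg_cst|exact: cvg_id].
  exact: sublevel_cdf_continuous.
apply: (@cvg_trans _ (g @ x)); last first.
  exact: (cvgD (cvgB (cvgB (cvg_cst _) (cH _)) (cH _)) (cvg_cst _)).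
apply: near_eq_cvg; near=> t.
rewrite /g -(@Phi_near m) //.
have : t \in `](m - 1)%:~R, (m + 1)%:~R[ by near: t; exact: near_in_itvoo.
by rewrite in_itv.
Unshelve. all: by end_near. Qed.

Lemma Phi0_0 : Phi tau 0 0 = 0.
Proof. by rewrite PhiE ceil0 subrr sublevel_cdf_le0 // subr0 addr0. Qed.

(** As [0 <= tau v < 1] almost everywhere, [tau v + t] lies in [[t, t + 1[], where the floor is
    [ceil t - 1] below [ceil t] and [ceil t] from there on. *)
Lemma floor_ae_indic t : ae_eq lambda I01
  (fun v => ((Num.floor (tau v + t))%:~R : R)%:E)
  (fun v => ((Num.ceil t)%:~R - \1_(sublevel ((Num.ceil t)%:~R - t)) v)%:E).
Proof.
have /andP[c1 c2] := ceil_itv t; rewrite intrB in c1.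
apply: negligibleS tau_itv => v /= nv h; apply: nv => vI; have vI' := mem_set vI.
have /andP[v0 v1] := h vI'; congr EFin.
rewrite indicE; have [vc|cv] := ltP (tau v) ((Num.ceil t)%:~R - t).
- rewrite mem_set //=.
  have -> : Num.floor (tau v + t) = Num.ceil t - 1.
    by apply: floor_def; rewrite subrK intrB; apply/andP; split; lra.
  by rewrite intrB.
- rewrite memNset /=; last by case=> _; lra.
  have -> : Num.floor (tau v + t) = Num.ceil t.
    by apply: floor_def; rewrite intrD; apply/andP; split; lra.
  by rewrite subr0.
Qed.

Lemma measurable_floor_shift t :
  measurable_fun I01 (fun v => (Num.floor (tau v + t))%:~R : R).
Proof.
apply: (@measurableT_comp _ _ _ _ _ _ (fun x : R => (Num.floor x)%:~R : R)).
  apply: nondecreasing_measurable => // x y xy.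
  by rewrite ler_int; exact: le_floor.
by apply: measurable_funD => //.
Qed.

Lemma integrable_cst_I01 (a : R) : lambda.-integrable I01 (EFin \o cst a).
Proof.
apply: measurable_bounded_integrable => //.
  exact: lebesgue_measure_I01_lty.
exact: bounded_cst.
Qed.

Lemma integrable_indic_sublevel c :
  lambda.-integrable I01 (EFin \o \1_(sublevel c)).
Proof.
apply: measurable_bounded_integrable => //.
- exact: lebesgue_measure_I01_lty.
- by apply: measurable_indic; exact: measurable_sublevel.
- exists 1; split => // M M1 v _ /=.
  by rewrite indicE normr_nat (le_trans _ (ltW M1)) // lern1 leq_b1.
Qed.

Lemma integrable_floor_shift t :
  lambda.-integrable I01 (EFin \o (fun v => (Num.floor (tau v + t))%:~R : R)).
Proof.
apply: ae_eq_integrable (floor_ae_indic t) _ => //.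
  by apply/measurable_EFinP; exact: measurable_floor_shift.
have := integrableB _ (integrable_cst_I01 (Num.ceil t)%:~R)
  (integrable_indic_sublevel ((Num.ceil t)%:~R - t)).
exact.
Qed.

Lemma Rintegral_floor_shift t :
  Rintegral lambda I01 (fun v => (Num.floor (tau v + t))%:~R) = Phi tau 0 t.
Proof.
rewrite PhiE addr0.
set A := sublevel ((Num.ceil t)%:~R - t).
have -> : Rintegral lambda I01 (fun v => (Num.floor (tau v + t))%:~R) =
    Rintegral lambda I01 (fun v => (Num.ceil t)%:~R - \1_A v).
  congr fine; apply: ae_eq_integral (floor_ae_indic t) => //.
  - by apply/measurable_EFinP; exact: measurable_floor_shift.
  - apply/measurable_EFinP/measurable_funB => //.
    by apply: measurable_indic; exact: measurable_sublevel.
rewrite RintegralB //; first last.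
- exact: integrable_indic_sublevel.
- exact: integrable_cst_I01.
rewrite Rintegral_cst_I01; congr (_ - _).
rewrite /Rintegral integral_indic //; last exact: measurable_sublevel.
by rewrite setIidl // => v [/set_mem].
Qed.

End Sublevel.

(** * Chip-firing on a constant graphon *)

Section ChipFiring.
Context {R : realType} (p : R) (sigma : R -> R).
Local Notation lambda := (@lebesgue_measure R).
Local Notation I01 := (`[0, 1]%classic : set R).
Local Notation W := (const_graphon p).
Local Notation tau := (fun v => 1 / p * sigma v).
Hypothesis p_gt0 : 0 < p.
Hypothesis tau_meas : measurable_fun I01 tau.
Hypothesis tau_itv : {ae lambda, forall v, v \in I01 -> 0 <= tau v < 1}.

Lemma deg_const_graphon x : deg W x = p.
Proof. exact: Rintegral_cst_I01. Qed.

Local Notation config y := (fun x => sigma x + y * deg W x).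
Local Notation orb y n := (iter n (fun t => Phi tau 0 t + y) y).

Lemma odometer_int eta n x : odometer W eta n x \is a Num.int.
Proof. by apply: rpred_sum => i _; rewrite /firing intr_int. Qed.

(** The odometer is an integer, so it leaves the floor of state over degree and cancels against the
    firings already counted. *)
Lemma odometerS_of_state y n x :
  iter n (update W) (config y) x =
    p * (tau x - odometer W (config y) n x + orb y n) ->
  odometer W (config y) n.+1 x = (Num.floor (tau x + orb y n))%:~R.
Proof.
move=> st; rewrite {1}/odometer big_ord_recr /= -/(odometer W (config y) n x).
rewrite /firing deg_const_graphon st.
have /intrP[k ->] := odometer_int (config y) n x.
move: (1 / p * _) (orb y n) => a b.
have -> : p * (a - k%:~R + b) / p = a + b + (- k)%:~R.
  by rewrite mulrNz; field; rewrite gt_eqF.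
by rewrite (@floorDrz _ (a + b)) ?intr_int // intrKfloor intrD mulrNz addrC subrK.
Qed.

(* [orb y n] is [y] plus the total mass fired before step [n]. *)
Lemma chip_firing_state y n :
  (forall x, iter n (update W) (config y) x =
     p * (tau x - odometer W (config y) n x + orb y n)) /\
  (lambda.-integrable I01 (EFin \o odometer W (config y) n) /\
   Rintegral lambda I01 (odometer W (config y) n) = orb y n - y).
Proof.
elim: n => [|n [IH [io Io]]].
  split => [x|].
    rewrite /= /odometer big_ord0 subr0 deg_const_graphon mulrDr mulrA div1r.
    by rewrite mulfV ?gt_eqF // mul1r (mulrC p).
  have -> : odometer W (config y) 0 = cst 0.
    by apply/funext => x; rewrite /odometer big_ord0.
  split; first exact: integrable_cst_I01.
  by rewrite /= subrr Rintegral_cst_I01.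
have uS : odometer W (config y) n.+1 =
    (fun x => (Num.floor (tau x + orb y n))%:~R).
  by apply/funext => x; exact: odometerS_of_state.
have ioS : lambda.-integrable I01 (EFin \o odometer W (config y) n.+1).
  by rewrite uS; exact: integrable_floor_shift.
have IoS : Rintegral lambda I01 (odometer W (config y) n.+1) = orb y n.+1 - y.
  by rewrite uS Rintegral_floor_shift //= addrK.
split; last by [].
have fE z : firing W (iter n (update W) (config y)) z =
    odometer W (config y) n.+1 z - odometer W (config y) n z.
  by rewrite [odometer _ _ n.+1 _]/odometer big_ord_recr /= addrAC subrr add0r.
move=> x; rewrite iterS {1}/update fE IH deg_const_graphon.
have -> : Rintegral lambda I01 (fun z =>
    firing W (iter n (update W) (config y)) z * W x z) =
    (orb y n.+1 - orb y n) * p.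
  under eq_Rintegral => z _ do rewrite fE.
  rewrite RintegralZr // ; last first.
    exact: (integrableB _ ioS io).
  by rewrite RintegralB // IoS Io; congr (_ * p); ring.
ring.
Qed.

Lemma odometerS_const_graphon y n x :
  odometer W (config y) n.+1 x = (Num.floor (tau x + orb y n))%:~R.
Proof. by apply: odometerS_of_state; have [+ _] := chip_firing_state y n. Qed.

Hypothesis tau_atom : forall c, lambda [set v | v \in I01 /\ tau v = c] = 0%E.

Local Notation rho := (rotation_number (Phi tau 0)).

Lemma odometer_rotation y x :
  (fun n => odometer W (config y) n x / n%:R) @ \oo --> rho y.
Proof.
(* The [3] is the orbit error [2] plus the floor error [1]; the [rho y] term arises because the
   odometer at [n.+1] is read off the orbit at [n]. *)
pose C := `|tau x| + `|y| + `|rho y| + 3.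
have aux (t z f c w : R) : f <= t + z -> t + z < f + 1 ->
    y + c - 2 <= z -> z <= y + c + 2 -> `|f - (c + w)| <= `|t| + `|y| + `|w| + 3.
  have := ler_norm t; have := ler_norm (- t); have := ler_norm y.
  have := ler_norm (- y); have := ler_norm w; have := ler_norm (- w).
  rewrite !normrN => ? ? ? ? ? ? ? ? ? ?.
  by rewrite ler_norml; apply/andP; split; lra.
have bnd n : `|odometer W (config y) n.+1 x - n.+1%:R * rho y| <= C.
  rewrite odometerS_const_graphon -natr1 mulrDl (mul1r (rho y)).
  have /andP[f1 f2] := floor_itv (tau x + orb y n); rewrite intrD in f2.
  have /andP[b1 b2] := orbit_rotation_bounds (Phi tau 0)
    (Phi_homo tau tau_meas 0) (Phi_add1 tau 0) y n y.
  exact: aux f1 f2 b1 b2.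
apply/cvgrPdist_lt => e e0; exists (Num.truncn (C / e)).+1 => // -[//|n] /= hn.
have n0 : 0 < n.+1%:R :> R by rewrite ltr0n.
rewrite -(ltr_pM2l n0) -[X in X * `|_|]gtr0_norm // -normrM mulrBr.
rewrite [_ * (_ / _)]mulrCA mulfV ?gt_eqF // mulr1 distrC.
apply: le_lt_trans (bnd n) _; rewrite -ltr_pdivrMr //.
by apply: lt_le_trans (truncnS_gt _) _; rewrite ler_nat.
Qed.

(** Convergence to [rho y] holds at every [x], so another limit would make all of [[0, 1]]
    exceptional although its measure is [1]. *)
Lemma activity_unique y a : is_activity W (config y) a -> a = rho y.
Proof.
move=> act; apply: contrapT => ne.
have : lambda.-negligible I01.
  apply: negligibleS act => x xI /= h; apply: ne.
  have c := h (mem_set xI).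
  exact: (cvg_unique _ c (odometer_rotation y x)).
move/(negligibleP lambda (measurable_itv _)) => h0.
have := lebesgue_measure_I01 (R := R); rewrite h0 => /(congr1 fine)/esym/eqP.
by rewrite /= oner_eq0.
Qed.

Lemma activity_rotation y : is_activity W (config y) (rho y).
Proof. by apply: aeW => x _; exact: odometer_rotation. Qed.

Lemma activity_diagram_rotation : activity_diagram W sigma = rho.
Proof.
apply/funext => y; apply: activity_unique.
(* An activity exists, so [xget] does not fall back on its default [0]. *)
rewrite /activity_diagram /activity; apply: xgetPex.
by exists (rho y); exact: activity_rotation.
Qed.

End ChipFiring.

(** * Passage to the circle and assembly of the theorem *)

(** Its contrapositive carries the hypothesis on circle maps over to their lifts: no iterate of a
    lift is an integer translation. *)
Lemma iter_circle_map_id (R : realType) (F : R -> R) (q : nat) (a : int) :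
  (forall t, F (t + 1) = F t + 1) -> (forall x, iter q F x = x + a%:~R) ->
  iter q (circle_map F) = id.
Proof.
move=> F1 per; apply/funext => z; rewrite -[z in RHS]reprK -[z in LHS]reprK.
have it n x : iter n (circle_map F) (\pi_(circle R)%qT x) =
    \pi_(circle R)%qT (iter n F x).
  by elim: n => //= n ->; rewrite circle_map_pi.
rewrite it per; apply/eqP; rewrite piE /= /eq_mod1 addrAC subrr add0r.
exact: intr_int.
Qed.

Theorem theorem6p6 (R : realType) (p : R) (sigma : R -> R)
    (hp : 0 < p <= 1)
    (hsigma : chip_configuration sigma)
    (hlt : {ae @lebesgue_measure R, forall v : R, v \in `[0, 1]%classic -> sigma v < p})
    (hatom : forall c : R,
       @lebesgue_measure R [set v | v \in `[0, 1]%classic /\ sigma v = c] = 0%E)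
    (hPhi : forall (y : R) (q : nat), 0 <= y <= 1 -> (1 <= q)%N ->
       iter q (circle_map (Phi (fun v => 1 / p * sigma v) y)) <> id) :
  let s := activity_diagram (const_graphon p) sigma in
  [/\ forall y : R,
        is_activity (const_graphon p)
          (fun x => sigma x + y * deg (const_graphon p) x) (s y),
      devils_staircase 0 1 s,
      forall alpha : R, irrational alpha ->
        exists y : R, s @^-1` [set alpha] = [set y] &
      forall r : R, rational r ->
        is_interval (s @^-1` [set r]) /\
        (0 < @lebesgue_measure R (s @^-1` [set r]))%E].
Proof.
case/andP: hp => p0 _; case: hsigma => isigma sigma0 s.
pose tau v := 1 / p * sigma v.
have msigma : measurable_fun (`[0, 1]%classic : set R) sigma.
  by apply/measurable_EFinP; exact: measurable_int isigma.
have tau_meas : measurable_fun (`[0, 1]%classic : set R) tau by exact: measurable_funM.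
have tau_itv : {ae @lebesgue_measure R,
    forall v, v \in `[0, 1]%classic -> 0 <= tau v < 1}.
  apply: negligibleS (negligibleU sigma0 hlt) => v /= nv.
  apply: contrapT => /not_orP[/contrapT h0 /contrapT h1]; apply: nv => vI.
  rewrite /tau div1r mulr_ge0 ?invr_ge0 ?(ltW p0) ?h0 //=.
  by rewrite mulrC ltr_pdivrMr // mul1r h1.
have tau_atom c :
    @lebesgue_measure R [set v | v \in `[0, 1]%classic /\ tau v = c] = 0%E.
  rewrite -(hatom (p * c)); congr (lebesgue_measure _).
  apply/seteqP; split => v /= [vI e]; split => //.
    by rewrite -e /tau; field; rewrite gt_eqF.
  by rewrite /tau e; field; rewrite gt_eqF.
pose G := Phi tau 0.
have G_cont : continuous G by exact: Phi_continuous.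
have G_homo : {homo G : x y / x <= y} by exact: Phi_homo.
have G_add1 x : G (x + 1) = G x + 1 by exact: Phi_add1.
have G0 : G 0 = 0 by exact: Phi0_0.
have PhiG y : Phi tau y = (fun t => G t + y).
  by apply/funext => t; rewrite /G /Phi addr0.
have not_periodic (y : R) (q : nat) (a : int) : 0 <= y <= 1 -> (0 < q)%N ->
    ~ (forall x, iter q (fun t => G t + y) x = x + a%:~R).
  move=> y01 q0 per; apply: (hPhi y q y01 q0).
  rewrite -/tau PhiG; apply: (@iter_circle_map_id _ _ _ a) per => t.
  by rewrite G_add1 addrAC.
have sE : s = rotation_number G by exact: activity_diagram_rotation.
have rho_homo := @rotation_number_homo _ G G_homo G_add1.
have rho_cont := @rotation_number_continuous _ G G_cont G_homo G_add1.
split.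
- by move=> y; rewrite sE; exact: activity_rotation.
- by rewrite sE; exact: rotation_number_devils_staircase.
- move=> a irr; have [y ya] := @rotation_number_surj _ G G_cont G_homo G_add1 G0 a.
  exists y; rewrite sE; apply/seteqP; split => [z /= za|_ /= ->//].
  by apply: (@rotation_number_irrational_inj _ G) => //; rewrite za.
- move=> r rr; rewrite sE; split.
    move=> x y /= xr yr z /andP[xz zy]; apply/eqP; rewrite eq_le.
    by rewrite -{1}yr -xr !rho_homo.
  have [y [y' [yy yr y'r]]] := @rotation_number_plateau _ G G_cont G_homo G_add1
    G0 not_periodic r rr.
  (* The level set contains the segment between two distinct points of the plateau; it is measurable
     because continuity makes it closed. *)
  apply: (@lt_le_trans _ _ (@lebesgue_measure R `[y, y']%classic)).
    by rewrite lebesgue_measure_itv /= lte_fin yy -EFinD lte_fin subr_gt0.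
  apply: le_measure; rewrite ?inE //.
  - apply: closed_measurable; apply: preimage_closed => // x _; exact: rho_cont.
  - move=> x /=; rewrite in_itv /= => /andP[yx xy']; apply/eqP.
    by rewrite eq_le -{1}y'r -yr !rho_homo.
Qed.
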